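(* For every integer $n\ge1$, $$\frac{6}{(n+1)^4}\le J_3(n)\le\frac{6\pi^2}{\left(n+\frac12\right)^2},$$ where $$J_3(n):=-\int_{(0,1)^2}\frac{\log^3(xy)\,P_n(x)P_n(y)}{1-xy}\,dx\,dy .$$
   Context: $P_n$ is the Legendre-type polynomial $P_n(x):=\frac{1}{n!}\frac{d^n}{dx^n}\bigl(x(1-x)\bigr)^n$. *)

(* Defs.v *)
From mathcomp Require Import all_boot all_order all_algebra.
From mathcomp Require Import all_classical all_reals all_analysis.

Set Implicit Arguments.
Unset Strict Implicit.
Unset Printing Implicit Defensive.

Import Order.TTheory GRing.Theory Num.Theory.
Import numFieldNormedType.Exports.

Local Open Scope classical_set_scope.
Local Open Scope ring_scope.

Definition legendreP (R : realType) (n : nat) : {poly R} :=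
  (n`!%:R)^-1 *: (('X * (1 - 'X)) ^+ n)^`(n).

(* [Rintegral] takes the junk value 0 when the integral diverges, including
   the case where both the positive and negative parts diverge; hence any
   strictly positive lower bound on [J3] entails that the integrand is
   Lebesgue integrable on the unit square. *)
Definition J3 (R : realType) (n : nat) : R :=
  - Rintegral (@lebesgue_measure R \x @lebesgue_measure R)%E
      (`]0, 1[ `*` `]0, 1[)
      (fun z : measurableTypeR R * measurableTypeR R =>
         ln (z.1 * z.2) ^+ 3 * (legendreP R n).[z.1] * (legendreP R n).[z.2]
         / (1 - z.1 * z.2)).

(* Main.v *)
Require Import Defs.
From mathcomp Require Import all_boot all_order all_algebra.
From mathcomp Require Import all_classical all_reals all_analysis.
From mathcomp Require Import measurable_realfun.
From mathcomp Require Import ring lra zify.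

Set Implicit Arguments.
Unset Strict Implicit.
Unset Printing Implicit Defensive.

Import Order.TTheory GRing.Theory Num.Theory.
Import numFieldNormedType.Exports.

Local Open Scope classical_set_scope.
Local Open Scope ring_scope.

(** Expanding 1/(1-xy) as a geometric series turns the double integral into
    the sum over k >= 0 of the integrals of log^3(xy) (xy)^k P_n(x) P_n(y).
    The integrand is dominated, since u^3/(1-e^(-u)) <= u^3 + u^2 with
    u = -log(xy), so the exchange is legitimate ([Rintegral_series]).

    Let g(s) be the integral of x^s P_n(x) over (0,1), up to the sign (-1)^n.
    Partial fractions give
      g(s) = s(s-1)...(s-n+1) / ((s+1)...(s+n+1))
    ([legendre_partial_fractions]), and inserting a power log^a x in the
    integral amounts to taking the a-th derivative of g.  The k-th term of the
    series is therefore the third derivative of g^2 at k, and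
      J_3(n) = - sum_k (g^2)'''(k).

    The size of J_3(n) is decided by the single term k = 0.  For k < n, g has a
    simple zero at k, and the term is 12 q(k)^2 L(k), where q = g/(s-k) and L is
    the logarithmic derivative of q ([moment_term_headE]).  With
    w = 1/(n(n+1))^2 one has q(0)^2 = w, so the term k = 0 of J_3(n) is
      12 w (H_(n-1) + H_(n+1))
    with H the harmonic numbers ([moment_term_0E]).  For 1 <= k < n, q(k)^2 is
    smaller than w by a factor (n+2)^2 at least ([root_frac_head_le]) while
    |L(k)| <= 2n; those n - 1 terms add up to at most 24 w n(n-1)/(n+2)^2.

    For k >= n every term is at most 40/(k+1)^5 in absolute value
    ([moment_term_tail_le]), and the sum of these telescopes to 10 w.  With
      x_j = (2j+1)/(k-j),  X = sum_j x_j,  P = prod_j (1 + x_j)  (0 <= j < n),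
    g(k) is at most 1/((k+1) P), while the sums of i-th powers that express the
    derivatives of log g are at most ((1 + X)/(k+1))^i.  The two effects
    balance because P grows at least like X^2/8 ([gap_ratio_prod_ge]): as
    x_(j+1) <= 6 x_j, no single x_j with j > 0 dominates the others.  Hence P^2
    absorbs every cubic polynomial in X.

    Altogether J_3(n) >= w (12 (H_(n-1) + H_(n+1)) - 24 n(n-1)/(n+2)^2 - 10),
    and this is at least 6 w, hence at least 6/(n+1)^4.  From H_m <= m comes
    J_3(n) <= w (27 n + 7) <= 24/(n+1/2)^2, and 24 <= 6 pi^2 as pi >= 2. *)

(** * Moments of powers of the logarithm on the unit interval *)

(** Antiderivative of x^p (-log x)^a, obtained by integrating by parts [a] times;
    on exp(-n) it is exp(-n(p+1)) times a polynomial in n. *)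
Fixpoint monlog_prim (R : realType) (p a : nat) (x : R) : R :=
  (if a is b.+1 then x ^+ p.+1 * (- ln x) ^+ a + a%:R * monlog_prim p b x
   else x ^+ p.+1) / p.+1%:R.

Lemma is_derive_monlog_prim (R : realType) (p a : nat) (x : R) (x0 : 0 < x) :
  is_derive x (1 : R) (monlog_prim p a) (x ^+ p * (- ln x) ^+ a).
Proof.
have dln := is_derive1_ln x0.
have p0 : p.+1%:R != 0 :> R by rewrite pnatr_eq0.
elim: a => [|a IH].
  have -> : monlog_prim p 0 = (p.+1%:R^-1 : R) \*: (id ^+ p.+1 : R -> R).
    by apply/funext => y /=; rewrite fctE mulrC.
  apply: is_derive_eq; rewrite /= expr0 mulr1 /GRing.scale /= mulr1.
  by rewrite mulrCA mulrA mulfV // mul1r.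
have -> : monlog_prim p a.+1 = (p.+1%:R^-1 : R) \*:
    ((id ^+ p.+1 : R -> R) * ((- (@ln R)) ^+ a.+1) + a.+1%:R \*: monlog_prim p a).
  by apply/funext => y /=; rewrite !fctE [LHS]mulrC.
apply: is_derive_eq; rewrite /= /GRing.scale /= !fctE.
have xn0 : x != 0 by rewrite gt_eqF.
rewrite !exprS.
move: (a.+1%:R) (p.+1%:R) (x ^+ p) ((- ln x) ^+ a) p0 => A P u v p0.
by field; rewrite p0 xn0.
Qed.

Lemma monlog_prim1 (R : realType) (p a : nat) :
  monlog_prim p a (1 : R) = a`!%:R / p.+1%:R ^+ a.+1.
Proof.
elim: a => [|a IH] /=; first by rewrite !expr1n fact0 expr1.
rewrite IH ln1 oppr0 expr0n /= mulr0 add0r factS natrM -!mulrA.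
by rewrite -invfM -exprSr.
Qed.

Lemma expRN_pow_cvg0 (R : realType) (a : nat) :
  (n%:R ^+ a * expR (- n%:R) : R) @[n --> \oo] --> (0 : R).
Proof.
apply: (@squeeze_cvgr _ _ _ _ (cst 0) (fun n => a.+1`!%:R * (n%:R)^-1)).
- near=> n.
  have n0 : (0 : R) < n%:R by rewrite ltr0n; near: n; exact: nbhs_infty_gt.
  rewrite mulr_ge0 ?exprn_ge0 ?expR_ge0 //=.
  rewrite expRN ler_pdivlMr // mulrAC -exprSr ler_pdivrMr ?expR_gt0 //.
  rewrite mulrC -ler_pdivrMr ?ltr0n ?fact_gt0 //.
  have := @expR_ge1Dxn R n%:R a (ler0n _ _).
  by apply: le_trans; rewrite lerDr ler01.
- exact: cvg_cst.
- rewrite -[X in _ --> X](mulr0 (a.+1`!%:R : R)).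
  apply: cvgM; first exact: cvg_cst.
  apply/gtr0_cvgV0; last exact: cvgr_idn.
  by near=> n; rewrite ltr0n; near: n; exact: nbhs_infty_gt.
Unshelve. all: end_near. Qed.

Lemma monlog_prim_cvg0 (R : realType) (p a : nat) :
  monlog_prim p a (expR (- n%:R) : R) @[n --> \oo] --> (0 : R).
Proof.
have base b : expR (- n%:R) ^+ p.+1 * (n%:R ^+ b) @[n --> \oo] --> (0 : R).
  apply: (@squeeze_cvgr _ _ _ _ (cst 0) (fun n => n%:R ^+ b * expR (- n%:R)));
    last 2 first.
  - exact: cvg_cst.
  - exact: expRN_pow_cvg0.
  near=> n; rewrite mulr_ge0 ?exprn_ge0 ?expR_ge0 //= mulrC ler_wpM2l ?exprn_ge0 //.
  by rewrite exprS -[leRHS]mulr1 ler_wpM2l ?expR_ge0 //.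
elim: a => [|a IH] /=; rewrite -[X in _ --> X](mul0r (p.+1%:R^-1 : R)).
  apply: cvgM; last exact: cvg_cst.
  by have := base 0; under eq_fun do rewrite expr0 mulr1.
apply: cvgM; last exact: cvg_cst.
rewrite -[X in _ --> X](addr0 (0 : R)); apply: cvgD.
  by have := base a.+1; under eq_fun do rewrite -[X in _ * X ^+ _]opprK -{2}[- _%:R]expRK.
rewrite -[X in _ --> X](mulr0 (a.+1%:R : R)).
by apply: cvgM => //; exact: cvg_cst.
Unshelve. all: end_near. Qed.

Lemma continuous_monlog (R : realType) (p a : nat) (x : R) : 0 < x ->
  {for x, continuous (fun x : R => x ^+ p * (- ln x) ^+ a)}.
Proof.
move=> x0; have dln := is_derive1_ln x0.
have d : derivable ((id ^+ p : R -> R) * ((- (@ln R)) ^+ a)) x 1.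
  exact: ex_derive.
move/derivable1_diffP/differentiable_continuous: d.
suff -> : (id ^+ p : R -> R) * ((- (@ln R)) ^+ a) =
    fun x : R => x ^+ p * (- ln x) ^+ a by [].
by apply/funext => y; rewrite !fctE.
Qed.

Lemma measurable_monlog (R : realType) (p a : nat) :
  measurable_fun `]0, (1 : R)[ (fun x : R => x ^+ p * (- ln x) ^+ a).
Proof.
apply: open_continuous_measurable_fun => //.
by move=> x; rewrite inE /= in_itv /= => /andP[x0 _]; exact: continuous_monlog.
Qed.

(** The integrand may be unbounded at 0, so (0,1] is exhausted by the intervals
    [exp(-n-1), 1]: the fundamental theorem of calculus applies on each of them
    and monotone convergence passes to the limit. *)
Lemma integral_monlog (R : realType) (p a : nat) :
  (\int[@lebesgue_measure R]_(x in `]0%R, 1%R[) (x ^+ p * (- ln x) ^+ a)%:E =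
  (a`!%:R / p.+1%:R ^+ a.+1)%:E)%E.
Proof.
pose f (x : R) := x ^+ p * (- ln x) ^+ a.
pose e n : R := expR (- n.+1%:R).
have e0 n : 0 < e n by exact: expR_gt0.
have e1 n : e n < 1 by rewrite -expR0 ltr_expR oppr_lt0 ltr0n.
have cf n : {within `[e n, 1], continuous f}.
  apply: continuous_in_subspaceT => x; rewrite inE /= in_itv /= => /andP[ex _].
  by apply: continuous_monlog; exact: lt_le_trans ex.
have FTC n : (\int[@lebesgue_measure R]_(x in `[e n, 1%R]) (f x)%:E =
    (monlog_prim p a 1)%:E - (monlog_prim p a (e n))%:E)%E.
  apply: continuous_FTC2 => //.
    have dF (x : R) : 0 < x -> derivable (@monlog_prim R p a) x 1.
      by move=> x0; have [] := is_derive_monlog_prim p a x0.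
    have cF (x : R) : 0 < x -> monlog_prim p a y @[y --> x] --> monlog_prim p a x.
      by move=> /dF/derivable1_diffP/differentiable_continuous.
    split => [x /[!in_itv]/= /andP[ex _]||].
    - by apply: dF; exact: lt_trans ex.
    - by apply: cvg_at_right_filter; exact: cF.
    - by apply: cvg_at_left_filter; exact: cF.
  move=> x /[!in_itv]/= /andP[ex _]; rewrite derive1E.
  by have [] := is_derive_monlog_prim p a (lt_trans (e0 n) ex).
have cup : \bigcup_n `[e n, 1]%classic = `]0, 1 : R]%classic.
  apply/seteqP; split => x /=.
    move=> [n _] /=; rewrite !in_itv /= => /andP[ex ->].
    by rewrite (lt_le_trans _ ex).
  rewrite in_itv /= => /andP[x0 x1].
  have [n nx] : exists n, - ln x < n.+1%:R.
    exists (Num.truncn (- ln x)); apply: le_lt_trans (truncnS_gt _); exact: lexx.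
  exists n => //=; rewrite in_itv /= x1 andbT /e -ler_ln ?posrE ?expR_gt0 // expRK.
  by rewrite lerNl ltW.
have mf n : measurable_fun `[e n, 1] (EFin \o f).
  apply/measurable_EFinP; apply: subspace_continuous_measurable_fun => //.
transitivity (\int[@lebesgue_measure R]_(x in `]0%R, 1%R]) (f x)%:E)%E.
  rewrite -integral_itv_bndo_bndc //.
  by apply/measurable_EFinP; exact: measurable_monlog.
rewrite -monlog_prim1 -cup.
have cvg1 : (\int[@lebesgue_measure R]_(x in `[e n, 1%R]) (f x)%:E)%E @[n --> \oo] -->
    (\int[@lebesgue_measure R]_(x in \bigcup_n `[e n, 1%R]%classic) (f x)%:E)%E.
  apply: ge0_nondecreasing_set_cvg_integral => //.
  - apply/nondecreasing_seqP => n; rewrite subsetEset.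
    by apply: subset_itvr; rewrite bnd_simp ler_expR lerN2 ler_nat.
  - move=> n x; rewrite /= in_itv /= => /andP[ex x1]; rewrite lee_fin mulr_ge0 //.
      by rewrite exprn_ge0 // ltW // (lt_le_trans _ ex).
    by rewrite exprn_ge0 // oppr_ge0 ln_le0.
have cvg2 : (\int[@lebesgue_measure R]_(x in `[e n, 1%R]) (f x)%:E)%E @[n --> \oo] -->
    (monlog_prim p a (1 : R))%:E.
  under eq_fun do rewrite FTC.
  have lim : ((monlog_prim p a 1)%:E - (monlog_prim p a (e n))%:E)%E @[n --> \oo] -->
      ((monlog_prim p a (1 : R))%:E - 0%:E)%E.
    apply: cvgeB; [by []|exact: cvg_cst|].
    apply: cvg_EFin; first exact: nearW.
    by have := @monlog_prim_cvg0 R p a; rewrite -(cvg_shiftS _).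
  by rewrite sube0 in lim.
exact: cvg_unique cvg1 cvg2.
Qed.

Lemma integrable_monlog (R : realType) (p a : nat) :
  (@lebesgue_measure R).-integrable `]0, (1 : R)[
    (fun x => (x ^+ p * (- ln x) ^+ a)%:E).
Proof.
apply/integrableP; split.
  by apply/measurable_EFinP; exact: measurable_monlog.
under eq_integral => x xI.
  rewrite gee0_abs; last first.
    move: xI; rewrite inE /= in_itv /= lee_fin => /andP[x0 x1].
    by rewrite mulr_ge0 ?exprn_ge0 // ?oppr_ge0 ?ln_le0 // ltW.
  over.
by rewrite integral_monlog ltry.
Qed.

(** * Product integrands and the series for the double integral *)

(** Tonelli, applied to the absolute values, gives integrability; Fubini then
    gives the value.  Both are used on the extensions by 0 outside [A] and [B]. *)
Lemma integrable_prodM d1 d2 (T1 : measurableType d1) (T2 : measurableType d2)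
    (R : realType) (m1 : {sigma_finite_measure set T1 -> \bar R})
    (m2 : {sigma_finite_measure set T2 -> \bar R})
    (A : set T1) (B : set T2) (f : T1 -> R) (g : T2 -> R) :
  measurable A -> measurable B ->
  m1.-integrable A (EFin \o f) -> m2.-integrable B (EFin \o g) ->
  (m1 \x m2)%E.-integrable (A `*` B) (fun z => (f z.1 * g z.2)%:E) /\
  (\int[m1 \x m2]_(z in A `*` B) (f z.1 * g z.2)%:E =
   (\int[m1]_(x in A) f x)%R%:E * (\int[m2]_(y in B) g y)%R%:E)%E.
Proof.
move=> mA mB intf intg.
pose f' : T1 -> R := f \_ A; pose g' : T2 -> R := g \_ B.
have intf' : m1.-integrable setT (EFin \o f').
  by rewrite -restrict_EFin; apply/(integrable_mkcond _ mA).
have intg' : m2.-integrable setT (EFin \o g').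
  by rewrite -restrict_EFin; apply/(integrable_mkcond _ mB).
have mAB : measurable (A `*` B) by exact: measurableX.
have E : (fun z => (f z.1 * g z.2)%:E) \_ (A `*` B) =
    (fun z => (f' z.1 * g' z.2)%:E).
  apply/funext => -[x y] /=; rewrite /f' /g' !patchE /= in_setX /=.
  by case: (x \in A); case: (y \in B); rewrite /= ?mul0r ?mulr0.
have mf' : measurable_fun setT f' by apply/measurable_EFinP; exact: measurable_int intf'.
have mg' : measurable_fun setT g' by apply/measurable_EFinP; exact: measurable_int intg'.
have mF : measurable_fun setT (fun z : T1 * T2 => (f' z.1 * g' z.2)%:E).
  by apply/measurable_EFinP/measurable_funM; apply: measurableT_comp.
have intF : (m1 \x m2)%E.-integrable setT (fun z => (f' z.1 * g' z.2)%:E).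
  apply/integrable12ltyP => //=.
  under eq_integral => x _.
    under eq_integral do rewrite normrM EFinM.
    rewrite ge0_integralZl//; last first.
      by apply/measurable_EFinP; exact: measurableT_comp.
    over.
  have /integrableP[_ /= fy] := intf'.
  have /integrableP[mg /= gy] := intg'.
  rewrite ge0_integralZr//; last 2 first.
    by apply/measurable_EFinP; exact: measurableT_comp.
    exact: integral_ge0.
  by rewrite lte_mul_pinfty // ?integral_ge0 // ge0_fin_numE // integral_ge0.
split; first by apply/(integrable_mkcond _ mAB); rewrite E.
rewrite integral_mkcond E -integral12_prod_meas1 //= /fubini_F /=.
under eq_integral => x _.
  under eq_integral do rewrite EFinM.
  rewrite integralZl//.
  over.
rewrite /Rintegral [in RHS]integral_mkcond [X in (_ * (fine X)%:E)%E]integral_mkcond.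
rewrite !restrict_EFin -/f' -/g'.
rewrite !fineK; [|exact: integrable_fin_num..].
have gfin : (\int[m2]_x (g' x)%:E)%E \is a fin_num by exact: integrable_fin_num.
by rewrite -(fineK gfin) integralZr.
Qed.

(** Integral of q(x) log^a x over (0,1), computed coefficient by coefficient
    (see [integral_polylog]). *)
Definition logmom (R : realType) (q : {poly R}) (a : nat) : R :=
  \sum_(i < size q) q`_i * ((-1) ^+ a * a`!%:R / i.+1%:R ^+ a.+1).

Lemma integral_polylog (R : realType) (q : {poly R}) (a : nat) :
  (@lebesgue_measure R).-integrable `]0, (1 : R)[
    (EFin \o (fun x => q.[x] * ln x ^+ a)) /\
  \int[@lebesgue_measure R]_(x in `]0, 1[) (q.[x] * ln x ^+ a) = logmom q a.
Proof.
have E (x : R) : (q.[x] * ln x ^+ a)%:E =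
    (\sum_(i < size q) (q`_i * (-1) ^+ a)%:E * (x ^+ i * (- ln x) ^+ a)%:E)%E.
  rewrite horner_coef mulr_suml -sumEFin; apply: eq_bigr => i _.
  rewrite -EFinM; congr EFin.
  rewrite -[in LHS](opprK (ln x)) [X in _ * X = _]exprNn.
  by move: ((- ln x) ^+ a) ((-1) ^+ a) => v s; ring.
have int i : (@lebesgue_measure R).-integrable `]0, (1 : R)[
    (fun x => ((q`_i * (-1) ^+ a)%:E * (x ^+ i * (- ln x) ^+ a)%:E)%E).
  by apply: integrableZl => //; exact: integrable_monlog.
split.
  have -> : EFin \o (fun x => q.[x] * ln x ^+ a) = fun x : R =>
      (\sum_(i < size q) (q`_i * (-1) ^+ a)%:E * (x ^+ i * (- ln x) ^+ a)%:E)%E.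
    by apply/funext => x; exact: E.
  by apply: integrable_sum => // i _; exact: int.
rewrite /Rintegral; under eq_integral do rewrite E.
rewrite integral_sum //.
under eq_bigr => i _.
  rewrite integralZl //; last exact: integrable_monlog.
  rewrite integral_monlog -EFinM.
  over.
rewrite sumEFin /= /logmom; apply: eq_bigr => i _.
by rewrite !mulrA.
Qed.

(** As log(xy) = log x + log y, the binomial formula writes the integrand as a
    sum of products of a function of x and a function of y. *)
Lemma integral_square_logM (R : realType) (q : {poly R}) (m : nat) :
  let D : set (measurableTypeR R * measurableTypeR R) := (`]0%R, 1%R[ `*` `]0%R, 1%R[)%classic in
  let mu := (@lebesgue_measure R \x @lebesgue_measure R)%E in
  let f (z : measurableTypeR R * measurableTypeR R) :=
    (ln (z.1 * z.2) ^+ m * (q.[z.1] * q.[z.2]))%:E in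
  mu.-integrable D f /\
  (\int[mu]_(z in D) f z)%E =
  (\sum_(b < m.+1) (logmom q (m - b) * logmom q b) *+ 'C(m, b))%:E.
Proof.
move=> D mu f.
have mI : measurable ([set` Interval (BRight (0 : R)) (BLeft 1)] : set (measurableTypeR R))
    by exact: measurable_itv.
have mD : measurable D by exact: measurableX.
pose g (b : nat) (z : measurableTypeR R * measurableTypeR R) :=
  ((q.[z.1] * ln z.1 ^+ (m - b)) * (q.[z.2] * ln z.2 ^+ b))%:E.
have Ig a b := @integrable_prodM _ _ _ _ R (@lebesgue_measure R) (@lebesgue_measure R)
  _ _ _ _ mI mI (integral_polylog q a).1 (integral_polylog q b).1.
have E z : D z -> f z = (\sum_(b < m.+1) ('C(m, b)%:R)%:E * g b z)%E.
  move=> [/=]; rewrite !in_itv /= => /andP[x0 _] /andP[y0 _].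
  rewrite /f lnM ?posrE // exprDn mulr_suml -sumEFin; apply: eq_bigr => b _.
  rewrite -EFinM mulr_natl mulrnAl; congr (_ *+ _)%:E; rewrite mulrACA.
  by rewrite mulrC mulrACA [RHS]mulrC mulrACA; ring.
have Ig' (b : nat) : mu.-integrable D (fun z => (('C(m, b)%:R)%:E * g b z)%E).
  by apply: integrableZl => //; exact: (Ig _ _).1.
split.
  apply: (@eq_integrable _ _ _ mu D mD
      (fun z => \sum_(b < m.+1) ('C(m, b)%:R)%:E * g b z)%E).
    by move=> z /[!inE] /E ->.
  by apply: integrable_sum => // b _; exact: Ig'.
transitivity (\int[mu]_(z in D) (\sum_(b < m.+1) ('C(m, b)%:R)%:E * g b z)%E)%E.
  by apply: eq_integral => z /[!inE] /E.
rewrite integral_sum // -sumEFin; apply: eq_bigr => b _.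
rewrite integralZl //; last exact: (Ig _ _).1.
by rewrite (Ig _ _).2 !(integral_polylog q _).2 -!EFinM mulr_natl.
Qed.

(** With x = exp(-u) this is u^3/(1-exp(-u)) <= u^3 + u^2, which
    reduces to exp u >= 1 + u.  It removes the singularity of 1/(1-xy). *)
Lemma log_ratio_le (R : realType) (x : R) : 0 < x < 1 ->
  - ln x ^+ 3 / (1 - x) <= - ln x ^+ 3 + ln x ^+ 2.
Proof.
move=> /andP[x0 x1].
have [u [u0 xu ->]] : exists u : R, [/\ 0 < u, x = expR (- u) & ln x = - u].
  exists (- ln x); split; rewrite ?opprK ?lnK ?posrE //.
  by rewrite oppr_gt0 ln_lt0 // x0.
have e1 := expR_ge1Dx u.
have xe : x * expR u = 1 by rewrite xu -expRD addNr expR0.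
have sx : x * (1 + u) <= 1 by rewrite -[leRHS]xe ler_wpM2l // ltW.
rewrite ler_pdivrMr ?subr_gt0 //.
have -> : - (- u) ^+ 3 = u ^+ 3 by ring.
have -> : (- u) ^+ 2 = u ^+ 2 by ring.
rewrite -subr_ge0.
have -> : (u ^+ 3 + u ^+ 2) * (1 - x) - u ^+ 3 = u ^+ 2 * (1 - x * (1 + u)) by ring.
apply: mulr_ge0; [exact: sqr_ge0|by rewrite subr_ge0].
Qed.

Lemma poly_bounded01 (R : realType) (P : {poly R}) :
  exists M : R, forall x, 0 < x < 1 -> `|P.[x]| <= M.
Proof.
exists (\sum_(i < size P) `|P`_i|) => x /andP[x0 x1].
rewrite horner_coef; apply: le_trans (ler_norm_sum _ _ _) _.
apply: ler_sum => i _; rewrite normrM -[leRHS]mulr1 ler_wpM2l //.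
by rewrite ger0_norm ?exprn_ge0 ?exprn_ile1 // ltW.
Qed.

(** Integral of log^3(xy) (xy)^k P(x) P(y) over the unit square, as computed by
    [integral_square_logM] for q = X^k P. *)
Definition moment_term (R : realType) (P : {poly R}) (k : nat) : R :=
  \sum_(b < 4) (logmom ('X^k * P) (3 - b) * logmom ('X^k * P) b) *+ 'C(3, b).

(** Dominated convergence for the partial sums of the geometric series of
    1/(1-xy): they equal the limit times 1 - (xy)^N, hence their absolute
    values are bounded by that of the limit, which [log_ratio_le] bounds by
    an integrable function. *)
Lemma Rintegral_series (R : realType) (P : {poly R}) :
  \sum_(0 <= k < N) moment_term P k @[N --> \oo] -->
  Rintegral (@lebesgue_measure R \x @lebesgue_measure R)%E
    ((`]0%R, 1%R[ `*` `]0%R, 1%R[)%classic)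
      (fun z : measurableTypeR R * measurableTypeR R =>
         ln (z.1 * z.2) ^+ 3 * P.[z.1] * P.[z.2] / (1 - z.1 * z.2)).
Proof.
set D : set (measurableTypeR R * measurableTypeR R) := (_ `*` _)%classic.
set mu := (_ \x _)%E; set F := fun z => _ / _.
pose t k (z : measurableTypeR R * measurableTypeR R) :=
  (ln (z.1 * z.2) ^+ 3 * (('X^k * P).[z.1] * ('X^k * P).[z.2])).
have mI : measurable ([set` Interval (BRight (0 : R)) (BLeft 1)] : set (measurableTypeR R))
  by exact: measurable_itv.
have mD : measurable D by exact: measurableX.
have It k := (integral_square_logM ('X^k * P) 3).1.
have int_t k := (integral_square_logM ('X^k * P) 3).2.
pose S (N : nat) z := (\sum_(0 <= k < N) t k z)%:E.
have D01 z : D z -> [/\ 0 < z.1 < 1, 0 < z.2 < 1 & 0 < z.1 * z.2 < 1].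
  move=> [/=]; rewrite !in_itv /= => /[dup] /andP[x0 x1] -> /[dup] /andP[y0 y1] ->.
  by split => //; rewrite mulr_gt0 //= mulr_ilt1 // ltW.
have SE N z : D z -> S N z = (F z * (1 - (z.1 * z.2) ^+ N))%:E.
  move=> /D01[_ _ /andP[a0 a1]]; rewrite /S; congr EFin.
  have a1' : 1 - z.1 * z.2 != 0 by rewrite subr_eq0 eq_sym lt_eqF.
  have -> : \sum_(0 <= k < N) t k z =
      (\sum_(0 <= k < N) (z.1 * z.2) ^+ k) * (ln (z.1 * z.2) ^+ 3 * (P.[z.1] * P.[z.2])).
    rewrite mulr_suml; apply: eq_bigr => k _.
    by rewrite /t !hornerM !hornerXn exprMn; ring.
  have -> : 1 - (z.1 * z.2) ^+ N = (1 - z.1 * z.2) * (\sum_(0 <= k < N) (z.1 * z.2) ^+ k).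
    by rewrite big_mkord -opprB subrX1 -mulNr opprB.
  rewrite /F; move: (\sum_(0 <= k < N) _) => s; field.
  by [].
have [M PM] := poly_bounded01 P.
(* The dominating function is M^2 (u^3 + u^2) with u = - ln (xy). *)
pose g (z : measurableTypeR R * measurableTypeR R) :=
  ((M ^+ 2)%:E * ((- 1)%:E * (ln (z.1 * z.2) ^+ 3 * ((1 : {poly R}).[z.1] * (1 : {poly R}).[z.2]))%:E +
    (ln (z.1 * z.2) ^+ 2 * ((1 : {poly R}).[z.1] * (1 : {poly R}).[z.2]))%:E))%E.
have Ig : mu.-integrable D g.
  apply: integrableZl => //; apply: integrableD => //.
    by apply: integrableZl => //; exact: (integral_square_logM 1 3).1.
  exact: (integral_square_logM 1 2).1.
have IS N : mu.-integrable D (S N).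
  have -> : S N = (fun z => \sum_(k <- index_iota 0 N) (t k z)%:E)%E.
    by apply/funext => z; rewrite sumEFin.
  by apply: integrable_sum => // k _; exact: It.
have SF z : D z -> S ^~ z @ \oo --> (F z)%:E.
  move=> Dz; have [_ _ /andP[a0 a1]] := D01 _ Dz.
  under eq_fun do rewrite SE //.
  apply: cvg_EFin; first exact: nearW.
  rewrite -[X in _ --> X]mulr1; apply: cvgM; first exact: cvg_cst.
  rewrite -[X in _ --> X]subr0; apply: cvgB; first exact: cvg_cst.
  by apply: cvg_expr; rewrite ger0_norm // ltW.
have mF : measurable_fun D (EFin \o F).
  by apply: (emeasurable_fun_cvg S) => // N; exact: measurable_int (IS N).
have Sg N z : D z -> (`|S N z| <= g z)%E.
  move=> Dz; have [z1 z2 za] := D01 _ Dz.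
  rewrite SE // /g /= !hornerC !mulr1 -!EFinM lee_fin mulN1r.
  have /andP[a0 a1] := za.
  have aN : 0 <= 1 - (z.1 * z.2) ^+ N <= 1.
    rewrite lerBlDr lerDl exprn_ge0 ?subr_ge0 ?exprn_ile1 // ltW //.
  have L : `|F z| <= M ^+ 2 * (- ln (z.1 * z.2) ^+ 3 + ln (z.1 * z.2) ^+ 2).
    have l3 : ln (z.1 * z.2) ^+ 3 <= 0.
      by rewrite exprn_odd_le0 // ln_le0 // ltW.
    rewrite /F 3!normrM normfV [`|1 - _|]gtr0_norm ?subr_gt0 //.
    rewrite (ler0_norm l3).
    have -> : - ln (z.1 * z.2) ^+ 3 * `|P.[z.1]| * `|P.[z.2]| / (1 - z.1 * z.2)
      = (`|P.[z.1]| * `|P.[z.2]|) * (- ln (z.1 * z.2) ^+ 3 / (1 - z.1 * z.2)) by ring.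
    apply: ler_pM; rewrite ?mulr_ge0 ?invr_ge0 ?oppr_ge0 ?subr_ge0 ?(ltW a1) //.
      by rewrite expr2 ler_pM ?PM.
    exact: log_ratio_le.
  rewrite (normrM (F z)) [X in _ * X]ger0_norm; last by case/andP: aN.
  apply: (le_trans _ L).
  by rewrite -[leRHS]mulr1 ler_wpM2l //; have /andP[] := aN.
have [IF _ lim] := @dominated_convergence _ _ _ mu D mD S (EFin \o F) g
  (fun N => measurable_int _ (IS N)) mF (aeW _ SF) Ig (aeW _ (fun z N => Sg N z)).
have Ffin : (\int[mu]_(z in D) (F z)%:E)%E \is a fin_num by exact: integrable_fin_num.
have {}lim : (\int[mu]_(z in D) S N z)%E @[N --> \oo] --> (Rintegral mu D F)%:E.
  by rewrite /Rintegral fineK.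
have ES N : (\int[mu]_(z in D) S N z)%E = (\sum_(0 <= k < N) moment_term P k)%:E.
  transitivity (\int[mu]_(z in D) (\sum_(k <- index_iota 0 N) (t k z)%:E)%E)%E.
    by apply: eq_integral => z _; rewrite sumEFin.
  rewrite integral_sum // -sumEFin; apply: eq_bigr => k _.
  exact: int_t.
by move/fine_cvg: lim; under eq_fun do rewrite /= ES.
Qed.

(** * Mellin moments of the Legendre polynomials as a rational function *)

(** The coefficient of X^(n+i) in X^n (1-X)^n is (-1)^i binomial(n,i); the n-th
    derivative multiplies it by the falling factorial n! binomial(n+i,n). *)
Lemma coef_legendreP (R : realType) (n i : nat) :
  (legendreP R n)`_i = (-1) ^+ i * ('C(n, i) * 'C(n + i, n))%:R.
Proof.
rewrite /legendreP coefZ coef_derivn exprMn coefXnM -[(n + i < n)%N]negbK -leqNgt.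
rewrite leq_addr /= addKn.
have -> : ((1 - 'X) ^+ n : {poly R})`_i = (-1) ^+ i * 'C(n, i)%:R.
  rewrite exprBn coef_sum.
  under eq_bigr => j _.
    rewrite expr1n mulr1 coefMn -['X^j]mul1r mulrA mulr1 -polyCN -[_ ^+ j]rmorphXn coefCM coefXn.
    over.
  have [ni|ni] := ltnP n i.
    rewrite big1 ?bin_small ?mulr0 // => j _.
    by rewrite eq_sym ltn_eqF ?mulr0 ?mul0rn // (leq_trans (ltn_ord j)).
  rewrite (bigD1 (Ordinal (ni : i < n.+1)%N)) //= eqxx mulr1 big1 ?addr0 ?mulr_natr // => j.
  by rewrite -val_eqE /= eq_sym => /negPf ->; rewrite mulr0 mul0rn.
have n0 : n`!%:R != 0 :> R by rewrite pnatr_eq0 -lt0n fact_gt0.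
rewrite -bin_ffact -[_ *+ (_ * _)]mulr_natr !natrM.
by rewrite [RHS](_ : _ = (-1) ^+ i * 'C(n, i)%:R * 'C(n + i, n)%:R) ?mulrA //; field.
Qed.

Lemma size_legendreP (R : realType) (n : nat) : (size (legendreP R n) <= n.+1)%N.
Proof.
apply/leq_sizeP => j nj; rewrite coef_legendreP bin_small ?mul0n ?mulr0 //.
Qed.

Lemma ltrN1_addS_gt0 (R : realType) (s : R) (j : nat) : -1 < s -> 0 < s + j.+1%:R.
Proof. by move=> s1; rewrite -natr1 addrCA ltr_wpDl // -[ltLHS](subrr 1) [ltRHS]addrC ltrD2l. Qed.

(** The zeros 0, ..., n-1 can be restricted by [p]: [predT] gives, up to sign, the
    integral of x^s P_n(x) over (0,1), and [predC1 k] the same function with its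
    simple zero at k divided out. *)
Definition root_frac (R : realType) (n : nat) (p : pred nat) (s : R) : R :=
  \prod_(j < n | p j) (s - j%:R) / \prod_(j < n.+1) (s + j.+1%:R).

Lemma prod_natr_subl (R : realType) (n : nat) :
  \prod_(j < n) (j%:R - n%:R : R) = (-1) ^+ n * n`!%:R.
Proof.
under eq_bigr do rewrite -opprB.
rewrite prodrN card_ord; congr (_ * _).
rewrite fact_prod big_add1 /= big_mkord natr_prod (reindex_inj rev_ord_inj) /=.
by apply: eq_bigr => j _; rewrite natrB // subKr.
Qed.

(** Value at -(k+1) of the product of the X + j + 1 with j <> k, that is, the
    denominator of the residue of [root_frac] there. *)
Lemma prod_natr_sub_neq (R : realType) (n k : nat) : (k <= n)%N ->
  \prod_(j < n.+1 | j != k :> nat) (j%:R - k%:R : R) = (-1) ^+ k * (k`! * (n - k)`!)%:R.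
Proof.
elim: n => [|n IH].
  by rewrite leqn0 => /eqP ->; rewrite big_mkcond big_ord1 /= expr0 mul1r.
rewrite leq_eqVlt big_mkcond big_ord_recr /= => /orP[/eqP ->|kn].
  rewrite eqxx /= mulr1 subnn muln1 -prod_natr_subl; apply: eq_bigr => j _.
  by rewrite neq_ltn ltn_ord.
rewrite gtn_eqF //= -big_mkcond /= IH // -natrB 1?ltnW // -mulrA -natrM -mulnA.
by rewrite [((n - k)`! * _)%N]mulnC subSn // -factS.
Qed.

Lemma prod_natr_shift (R : realType) (n k : nat) :
  \prod_(i < n) (k.+1%:R + i%:R : R) * k`!%:R = (k + n)`!%:R.
Proof.
elim: n => [|n IH]; first by rewrite big_ord0 mul1r addn0.
by rewrite big_ord_recr /= mulrAC IH -natrD -natrM addnS factS mulnC addSn.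
Qed.

(** After clearing denominators, both sides are polynomials of degree at most n
    in s; they agree at the n + 1 points -1, ..., -n-1, because the coefficients
    of P_n are the residues of the right-hand side. *)
Lemma legendre_partial_fractions (R : realType) (n : nat) (s : R) : -1 < s ->
  \sum_(i < n.+1) (legendreP R n)`_i / (s + i.+1%:R) = (-1) ^+ n * root_frac n predT s.
Proof.
move=> s1.
(* A and B are the two sides multiplied by all the s + j + 1. *)
pose A : {poly R} := \sum_(i < n.+1) (legendreP R n)`_i *:
  \prod_(j < n.+1 | j != i) ('X + (j.+1%:R)%:P).
pose B : {poly R} := (-1) ^+ n *: \prod_(j < n) ('X - (j%:R)%:P).
have AB : A = B.
  pose rs : seq R := [seq - i.+1%:R | i <- iota 0 n.+1].
  apply/eqP; rewrite -subr_eq0; apply/negPn/negP => AB0.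
  have urs : uniq rs.
    by rewrite map_inj_uniq ?iota_uniq // => i j /oppr_inj/eqP; rewrite eqr_nat => /eqP[].
  have size2 (c : R) : size ('X + c%:P) = 2%N by rewrite size_XaddC.
  have sAB : (size (A - B)%R <= n.+1)%N.
    rewrite (leq_trans (size_polyD _ _)) // size_polyN geq_max; apply/andP; split.
      rewrite /A (leq_trans (size_sum _ _ _)) //; apply/bigmax_leqP => i _.
      rewrite (leq_trans (size_scale_leq _ _)) // (leq_trans (size_prod_leq _ _)) //.
      under eq_bigr do rewrite size2.
      by rewrite sum_nat_const cardC1 card_ord /= muln2 -addnn -addSn addnK.
    rewrite /B (leq_trans (size_scale_leq _ _)) // (leq_trans (size_prod_leq _ _)) //.
    under eq_bigr do rewrite size_XsubC.
    by rewrite sum_nat_const card_ord muln2 -addnn -addSn addnK.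
  suff rsAB : all (root (A - B)) rs.
    have := @max_poly_roots _ (A - B) rs AB0 rsAB urs.
    by rewrite size_map size_iota ltnNge sAB.
  apply/allP => _ /mapP[k /[!mem_iota] /= /[!add0n] kn ->].
  rewrite rootE hornerD hornerN subr_eq0 /A /B hornerZ horner_prod horner_sum.
  rewrite (bigD1 (Ordinal kn)) //= [X in _ + X]big1 ?addr0 => [|i ik]; last first.
    rewrite hornerZ horner_prod (bigD1 (Ordinal kn)) /= 1?eq_sym //.
    by rewrite hornerD hornerX hornerC addNr mul0r mulr0.
  rewrite hornerZ horner_prod coef_legendreP.
  under eq_bigr do rewrite hornerD hornerX hornerC addrC.
  rewrite (eq_big (fun j : 'I_n.+1 => j != k :> nat)
    (fun j : 'I_n.+1 => j%:R - k%:R)) => [|j|j _]; last 2 first.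
  - by rewrite -val_eqE.
  - by rewrite -!natr1 opprD addrACA subrr addr0.
  rewrite prod_natr_sub_neq // mulrACA -signr_odd -expr2 sqrr_sign mul1r -natrM.
  under eq_bigr do rewrite hornerXsubC -opprD.
  rewrite prodrN card_ord mulrA -signr_odd -expr2 sqrr_sign mul1r.
  have kn' : (k <= n)%N by [].
  have k0 : k`!%:R != 0 :> R by rewrite pnatr_eq0 -lt0n fact_gt0.
  have := @bin_fact (n + k) n (leq_addr _ _); rewrite addKn => b2.
  apply/eqP/(mulIf k0); rewrite prod_natr_shift -natrM.
  by rewrite [('C(n, k) * _ * _)%N]mulnAC bin_fact // [(n`! * _)%N]mulnC -mulnA b2 addnC.
have d0 (i : nat) : s + i.+1%:R != 0.
  by rewrite gt_eqF // ltrN1_addS_gt0.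
have := congr1 (fun p => p.[s]) AB; rewrite /A /B hornerZ horner_prod.
under [in RHS]eq_bigr do rewrite hornerXsubC.
rewrite horner_sum => E.
have D0 : \prod_(j < n.+1) (s + j.+1%:R) != 0 by apply/prodf_neq0.
rewrite /root_frac /= mulrA -E mulr_suml; apply: eq_bigr => i _.
have DE : \prod_(j < n.+1) (s + j.+1%:R) =
    (s + i.+1%:R) * \prod_(j < n.+1 | j != i) (s + j.+1%:R) by rewrite (bigD1 i).
have D1 : \prod_(j < n.+1 | j != i) (s + j.+1%:R) != 0 by apply/prodf_neq0.
rewrite hornerZ horner_prod DE.
under eq_bigr do rewrite hornerD hornerX hornerC.
by rewrite invfM -mulrA [X in _ = _ * X]mulrCA mulfV ?mulr1.
Qed.

(** For m = 1 this is the logarithmic derivative of [root_frac]; for general m it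
    is its (m-1)-st derivative divided by (-1)^(m-1) (m-1)!. *)
Definition pole_sum (R : realType) (n : nat) (p : pred nat) (m : nat) (s : R) : R :=
  \sum_(j < n | p j) ((s - j%:R) ^+ m)^-1 - \sum_(j < n.+1) ((s + j.+1%:R) ^+ m)^-1.

Lemma is_derive_bigsum (R : realType) (I : Type) (r : seq I) (P : pred I)
    (f : I -> R -> R) (df : I -> R) (x : R) :
  (forall i, P i -> is_derive x 1 (f i) (df i)) ->
  is_derive x 1 (fun y => \sum_(i <- r | P i) f i y) (\sum_(i <- r | P i) df i).
Proof.
move=> H; elim: r => [|i r IH].
  have -> : (fun y => \sum_(i <- [::] | P i) f i y) = cst 0.
    by apply/funext => y; rewrite big_nil.
  by rewrite big_nil; exact: is_derive_cst.
rewrite big_cons; under eq_fun do rewrite big_cons.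
by case: ifPn => // /H dfi; exact: is_deriveD.
Qed.

(** The factors may vanish at [x]: it suffices that each derivative is a multiple
    of the factor, which is what makes logarithmic derivatives add up. *)
Lemma is_derive_bigprod (R : realType) (I : Type) (r : seq I) (P : pred I)
    (f l : I -> R -> R) (x : R) :
  (forall i, P i -> is_derive x 1 (f i) (f i x * l i x)) ->
  is_derive x 1 (fun y => \prod_(i <- r | P i) f i y)
    (\prod_(i <- r | P i) f i x * \sum_(i <- r | P i) l i x).
Proof.
move=> H; elim: r => [|i r IH].
  have -> : (fun y => \prod_(i <- [::] | P i) f i y) = cst 1.
    by apply/funext => y; rewrite big_nil.
  by rewrite !big_nil mulr0; exact: is_derive_cst.
rewrite !big_cons; under eq_fun do rewrite big_cons.
case: ifPn => // /H dfi.
apply: is_derive_eq; rewrite /GRing.scale /=; ring.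
Qed.

Lemma is_derive_shift_inv (R : realType) (c : R) (m : nat) (x : R) : x + c != 0 ->
  is_derive x 1 (fun y => ((y + c) ^+ m)^-1) (- m%:R * ((x + c) ^+ m.+1)^-1).
Proof.
move=> xc.
have d : is_derive x 1 ((id + cst c : R -> R) ^+ m) (m%:R * (x + c) ^+ m.-1).
  by apply: is_derive_eq; rewrite /GRing.scale /= addr0 mulr1.
have -> : (fun y => ((y + c) ^+ m)^-1) = (fun y => (((id + cst c : R -> R) ^+ m) y)^-1).
  by apply/funext => y; rewrite !fctE.
have nz : ((id + cst c : R -> R) ^+ m) x != 0 by rewrite !fctE expf_neq0.
apply: (is_derive_eq (is_deriveV nz d)).
rewrite /GRing.scale /= !fctE.
case: m {d nz} => [|m]; first by rewrite !mul0r oppr0 mul0r mulr0.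
by rewrite !exprS /=; move: ((x + c) ^+ m) (expf_neq0 m xc) => u u0; field; rewrite u0 xc.
Qed.

Lemma is_derive_pole_sum (R : realType) (n : nat) (p : pred nat) (m : nat) (s : R) :
  -1 < s -> (forall j, (j < n)%N -> p j -> s != j%:R) ->
  is_derive s 1 (pole_sum n p m) (- m%:R * pole_sum n p m.+1 s).
Proof.
move=> s1 sn; rewrite /pole_sum mulrBr !mulr_sumr.
apply: is_deriveB; apply: is_derive_bigsum => j pj; apply: is_derive_shift_inv.
  by rewrite subr_eq0 sn.
by rewrite gt_eqF // ltrN1_addS_gt0.
Qed.

Lemma is_derive_root_frac (R : realType) (n : nat) (p : pred nat) (s : R) :
  -1 < s -> (forall j, (j < n)%N -> p j -> s != j%:R) ->
  is_derive s 1 (root_frac n p) (root_frac n p s * pole_sum n p 1 s).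
Proof.
move=> s1 sn.
have d0 (j : nat) : s + j.+1%:R != 0.
  by rewrite gt_eqF // ltrN1_addS_gt0.
have dN : is_derive s 1 (fun y => \prod_(j < n | p j) (y - j%:R))
    (\prod_(j < n | p j) (s - j%:R) * \sum_(j < n | p j) (s - j%:R)^-1).
  apply: (@is_derive_bigprod _ _ _ _ (fun j : 'I_n => fun y => y - j%:R)
    (fun j : 'I_n => fun y => (y - j%:R)^-1)) => j pj.
  rewrite mulfV ?subr_eq0 ?sn //; apply: is_derive_eq.
  by rewrite subr0.
have dD : is_derive s 1 (fun y => \prod_(j < n.+1) (y + j.+1%:R))
    (\prod_(j < n.+1) (s + j.+1%:R) * \sum_(j < n.+1) (s + j.+1%:R)^-1).
  apply: (@is_derive_bigprod _ _ _ _ (fun j : 'I_n.+1 => fun y => y + j.+1%:R)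
    (fun j : 'I_n.+1 => fun y => (y + j.+1%:R)^-1)) => j pj.
  rewrite mulfV //; apply: is_derive_eq.
  by rewrite addr0.
have D0 : \prod_(j < n.+1) (s + j.+1%:R) != 0 by apply/prodf_neq0.
have -> : root_frac n p = (fun y => \prod_(j < n | p j) (y - j%:R)) *
    (fun y => (\prod_(j < n.+1) (y + j.+1%:R))^-1) by [].
apply: (is_derive_eq (is_deriveM dN (is_deriveV D0 dD))).
rewrite /pole_sum /GRing.scale /= !fctE.
move: D0; set D := \prod_(j < n.+1) _; set N := \prod_(j < n | _) _ => D0.
under [X in _ = _ * (X - _)]eq_bigr do rewrite expr1.
under [X in _ = _ * (_ - X)]eq_bigr do rewrite expr1.
by field.
Qed.

(** Integral of x^s log^a x P_n(x) over (0,1), with the sign (-1)^n of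
    [legendre_partial_fractions] removed; in this form s can be real and
    differentiation in s raises a by one. *)
Definition legendre_moment (R : realType) (n a : nat) (s : R) : R :=
  (-1) ^+ n * \sum_(i < n.+1) (legendreP R n)`_i *
    ((-1) ^+ a * a`!%:R / (s + i.+1%:R) ^+ a.+1).

(** Multiplication by X^k shifts the exponents, and so evaluates the moments
    at s = k. *)
Lemma logmom_legendre (R : realType) (n k a : nat) :
  logmom ('X^k * legendreP R n) a = (-1) ^+ n * legendre_moment n a (k%:R : R).
Proof.
rewrite /legendre_moment mulrA -exprD -signr_odd oddD addbb expr0 mul1r.
set q := _ * _.
have sq : (size q <= k + n.+1)%N.
  apply/leq_sizeP => j kj; rewrite coefXnM ltnNge (leq_trans _ kj) ?leq_addr //=.
  by rewrite (leq_sizeP _ _ (size_legendreP R n)) // leq_subRL // (leq_trans _ kj) ?leq_addr.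
pose F (i : nat) := q`_i * ((-1) ^+ a * a`!%:R / i.+1%:R ^+ a.+1).
rewrite /logmom -/q (big_ord_widen _ F sq) big_mkcond /=.
have -> : \sum_(i < k + n.+1) (if (i < size q)%N then F i else 0) = \sum_(i < k + n.+1) F i.
  apply: eq_bigr => i _; case: ltnP => // qi.
  by rewrite /F nth_default // mul0r.
rewrite big_split_ord /= big1 ?add0r => [|i _].
  apply: eq_bigr => i _; rewrite /F /q coefXnM ltnNge leq_addr /= addKn.
  by rewrite -addnS natrD.
by rewrite /F /q coefXnM ltn_ord mul0r.
Qed.

Lemma moment_term_legendre (R : realType) (n k : nat) :
  let m a := legendre_moment n a (k%:R : R) in
  moment_term (legendreP R n) k = 2 * (m 0 * m 3) + 6 * (m 1 * m 2).
Proof.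
move=> m; rewrite /moment_term !big_ord_recr big_ord0 /= !logmom_legendre -/(m _) /=.
have s2 : (-1) ^+ n * (-1) ^+ n = 1 :> R by rewrite -expr2 sqrr_sign.
have E a b : (-1) ^+ n * m a * ((-1) ^+ n * m b) = m a * m b.
  by rewrite mulrACA s2 mul1r.
rewrite !subnE /= !E (_ : 'C(3, 0) = 1%N) // (_ : 'C(3, 1) = 3%N) // (_ : 'C(3, 2) = 3%N) // (_ : 'C(3, 3) = 1%N) //.
by ring.
Qed.

Lemma is_derive_legendre_moment (R : realType) (n a : nat) (s : R) : -1 < s ->
  is_derive s 1 (@legendre_moment R n a) (legendre_moment n a.+1 (s : R)).
Proof.
move=> s1.
have d0 (j : nat) : s + j.+1%:R != 0.
  by rewrite gt_eqF // ltrN1_addS_gt0.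
have -> : @legendre_moment R n a = ((-1) ^+ n : R) \*: (fun y => \sum_(i < n.+1)
    ((legendreP R n)`_i * ((-1) ^+ a * a`!%:R)) * ((y + i.+1%:R) ^+ a.+1)^-1).
  apply/funext => y; rewrite /legendre_moment /=; congr (_ * _).
  by apply: eq_bigr => i _; rewrite mulrA.
rewrite /legendre_moment; apply: is_deriveZ.
have : forall i : 'I_n.+1, is_derive s 1 (fun y =>
    ((legendreP R n)`_i * ((-1) ^+ a * a`!%:R)) * ((y + i.+1%:R) ^+ a.+1)^-1)
    ((legendreP R n)`_i * ((-1) ^+ a.+1 * a.+1`!%:R / (s + i.+1%:R) ^+ a.+2)).
  move=> i.
  apply: (is_derive_eq (is_deriveZ ((legendreP R n)`_i * ((-1) ^+ a * a`!%:R))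
    (is_derive_shift_inv a.+1 (d0 i)))).
  rewrite /GRing.scale /= factS natrM [(-1) ^+ a.+1]exprS.
  by rewrite !mulNr !mulrN mul1r; congr (- _); rewrite !mulrA; ring.
by move=> H; exact: is_derive_bigsum.
Qed.

Lemma legendre_moment0 (R : realType) (n : nat) (s : R) : -1 < s ->
  legendre_moment n 0 (s : R) = root_frac n predT s.
Proof.
move=> s1; rewrite /legendre_moment.
under eq_bigr do rewrite fact0 expr0 mulr1 mul1r expr1.
by rewrite legendre_partial_fractions // mulrA -expr2 sqrr_sign mul1r.
Qed.

(** Two expressions of the same function near a point have the same derivative
    there; this transfers formulas from the product form of the moments to
    their partial fractions. *)
Lemma is_derive_itv_unique (R : realType) (f g : R -> R) (a b x df dg : R) :
  a < x < b -> (forall y, a < y < b -> f y = g y) ->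
  is_derive x 1 f df -> is_derive x 1 g dg -> df = dg.
Proof.
move=> /andP[ax xb] fg fdf [_ <-].
have /near_eq_is_derive/(_ fdf)[_ <- //] : \near x, f x = g x.
near=> y; apply: fg; apply/andP; split; near: y.
  exact: lt_nbhsr.
exact: lt_nbhsl.
Unshelve. all: by end_near. Qed.

(** * The terms of the series as third derivatives *)

(** No zero lies at distance less than 1 from k, so g and its logarithmic
    derivative L 1 are smooth there, with (L i)' = - i L (i+1).  Writing the
    first three derivatives of g as g times polynomials in the L i and
    collecting the third derivative of g^2 gives the formula. *)
Lemma moment_term_tailE (R : realType) (n k : nat) : (n <= k)%N ->
  let g := root_frac n predT (k%:R : R) in
  let L i := pole_sum n predT i (k%:R : R) in
  moment_term (legendreP R n) k =
    g ^+ 2 * (8 * L 1 ^+ 3 - 12 * (L 1 * L 2) + 4 * L 3).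
Proof.
move=> nk g L.
pose U (s : R) := k%:R - 1 < s < k%:R + 1.
have Uk : U k%:R by rewrite /U gtrBl ltrDl ltr01.
have U1 s : U s -> -1 < s.
  by move=> /andP[ks _]; apply: le_lt_trans ks; rewrite lerBrDr addNr ler0n.
have Un s : U s -> forall j, (j < n)%N -> predT j -> s != j%:R.
  move=> /andP[ks _] j jn _; rewrite gt_eqF //; apply: le_lt_trans ks.
  by rewrite lerBrDr natr1 ler_nat (leq_trans jn).
pose G := @root_frac R n predT; pose P i := @pole_sum R n predT i.
have dG s : U s -> is_derive s 1 G (G s * P 1%N s).
  by move=> Us; exact: is_derive_root_frac (U1 _ Us) (Un _ Us).
have dP i s : U s -> is_derive s 1 (P i) (- i%:R * P i.+1 s).
  by move=> Us; exact: is_derive_pole_sum (U1 _ Us) (Un _ Us).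
have dm a s : U s -> is_derive s 1 (@legendre_moment R n a) (legendre_moment n a.+1 s).
  by move=> Us; exact: is_derive_legendre_moment (U1 _ Us).
have m0 s : U s -> legendre_moment n 0 s = G s.
  by move=> Us; rewrite legendre_moment0 ?U1.
have m1 s : U s -> legendre_moment n 1 s = (G * P 1%N) s.
  by move=> Us; apply: (is_derive_itv_unique Us m0 (dm _ _ Us) (dG _ Us)).
have m2 s : U s -> legendre_moment n 2 s = (G * (P 1%N ^+ 2 - P 2%N)) s.
  move=> Us; have dGs := dG _ Us; have dPs := dP 1%N _ Us.
  rewrite (is_derive_itv_unique Us m1 (dm _ _ Us) (is_deriveM dGs dPs)).
  by rewrite !fctE /GRing.scale /=; ring.
have m3 s : U s -> legendre_moment n 3 s =
    G s * (P 1%N s ^+ 3 - 3 * (P 1%N s * P 2%N s) + 2 * P 3%N s).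
  move=> Us; have dGs := dG _ Us; have dP1 := dP 1%N _ Us; have dP2 := dP 2%N _ Us.
  have dQ := is_deriveB (is_deriveX 2 dP1) dP2.
  rewrite (is_derive_itv_unique Us m2 (dm _ _ Us) (is_deriveM dGs dQ)).
  by rewrite !fctE /GRing.scale /=; ring.
rewrite moment_term_legendre m0 // m1 // m2 // m3 // !fctE -/(L 1) /G -/g.
rewrite /P -/(L 1) -/(L 2) -/(L 3); ring.
Qed.

(** Near k the moment function is (s-k) q(s).  At k it vanishes, its first
    derivative is q and its second one 2 q', so only 6 g' g'' survives in the
    third derivative of g^2. *)
Lemma moment_term_headE (R : realType) (n k : nat) : (k < n)%N ->
  let q := root_frac n (predC1 k) (k%:R : R) in
  moment_term (legendreP R n) k = 12 * (q ^+ 2 * pole_sum n (predC1 k) 1%N (k%:R : R)).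
Proof.
move=> kn q.
pose U (s : R) := k%:R - 1 < s < k%:R + 1.
have Uk : U k%:R by rewrite /U gtrBl ltrDl ltr01.
have U1 s : U s -> -1 < s.
  by move=> /andP[ks _]; apply: le_lt_trans ks; rewrite lerBrDr addNr ler0n.
have Un s : U s -> forall j, (j < n)%N -> predC1 k j -> s != j%:R.
  move=> /andP[k1 k2] j jn /= jk; case: (ltngtP j k) jk => // jk _.
    rewrite gt_eqF //; apply: le_lt_trans k1.
    by rewrite lerBrDr natr1 ler_nat.
  by rewrite lt_eqF //; apply: (lt_le_trans k2); rewrite natr1 ler_nat.
pose G := @root_frac R n (predC1 k); pose P i := @pole_sum R n (predC1 k) i.
have dG s : U s -> is_derive s 1 G (G s * P 1%N s).
  by move=> Us; exact: is_derive_root_frac (U1 _ Us) (Un _ Us).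
have dP i s : U s -> is_derive s 1 (P i) (- i%:R * P i.+1 s).
  by move=> Us; exact: is_derive_pole_sum (U1 _ Us) (Un _ Us).
have dm a s : U s -> is_derive s 1 (@legendre_moment R n a) (legendre_moment n a.+1 s).
  by move=> Us; exact: is_derive_legendre_moment (U1 _ Us).
pose X : R -> R := id + cst (- k%:R).
have dX (s : R) : is_derive s 1 X 1.
  have := is_deriveD (is_derive_id s 1) (is_derive_cst (- k%:R : R) s 1). by rewrite addr0.
have Gk : G k%:R = q by [].
have Xk : X k%:R = 0 by exact: subrr.
have m0 s : U s -> legendre_moment n 0 s = (X * G) s.
  move=> Us; rewrite legendre_moment0 ?U1 // /G /root_frac !fctE mulrA; congr (_ / _).
  by rewrite (bigD1 (Ordinal kn)).
have m1 s : U s -> legendre_moment n 1 s = (G + X * (G * P 1%N)) s.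
  move=> Us; have dGs := dG _ Us.
  rewrite (is_derive_itv_unique Us m0 (dm _ _ Us) (is_deriveM (dX s) dGs)).
  by rewrite !fctE /GRing.scale /=; ring.
have m2 : legendre_moment n 2 k%:R = 2 * (q * P 1%N k%:R).
  have dGs := dG _ Uk; have dPs := dP 1%N _ Uk.
  have dQ := is_deriveD dGs (is_deriveM (dX k%:R) (is_deriveM dGs dPs)).
  rewrite (is_derive_itv_unique Uk m1 (dm _ _ Uk) dQ).
  by rewrite !fctE /GRing.scale /= Xk Gk; ring.
rewrite moment_term_legendre m0 // m1 // m2 // !fctE Xk Gk /P; ring.
Qed.

(** * The tail of the series *)

(** The excess over 1 of the ratio (k+j+1)/(k-j) of the distances from k to the
    pole -(j+1) and to the zero j. *)
Definition gap_ratio (R : realType) (k j : nat) : R := j.*2.+1%:R / (k%:R - j%:R).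

Lemma gap_ratio_ge0 (R : realType) (k j : nat) : (j < k)%N -> 0 <= gap_ratio R k j.
Proof. by move=> jk; rewrite divr_ge0 // subr_ge0 ler_nat ltnW. Qed.

Lemma gap_ratio1 (R : realType) (k j : nat) : (j < k)%N ->
  1 + gap_ratio R k j = (k%:R + j.+1%:R) / (k%:R - j%:R).
Proof.
move=> jk; have kj : k%:R - j%:R != 0 :> R by rewrite subr_eq0 eqr_nat gtn_eqF.
rewrite /gap_ratio -addnn -addnS natrD -natr1.
by move: (j%:R) (k%:R) kj => u v kj; field.
Qed.

(** Induction on the number of factors.  For n > 0, x_n <= 6 x_(n-1) <= 6 X, so a
    new factor 1 + x_n increases 7/8 + X + X^2/8 by at most x_n (1 + X), and it
    increases the product at least by as much.  The constant 7/8 leaves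
    room for the first factor, where X is still 0 and only x_0 <= 1 is known. *)
Lemma gap_ratio_prod_ge (R : realType) (k n : nat) : (n <= k)%N ->
  let X := \sum_(j < n) gap_ratio R k j in
  let P := \prod_(j < n) (1 + gap_ratio R k j) in
  [/\ 0 <= X, 1 + X <= P & 7 / 8 + X + X ^+ 2 / 8 <= P].
Proof.
elim: n => [|n IH] nk /=; first by rewrite !big_ord0; split; lra.
rewrite !big_ord_recr /=.
have {IH} := IH (ltnW nk) => /=.
set X := \sum_(j < n) _; set P := \prod_(j < n) _; set x := gap_ratio R k n.
move=> [X0 XP1 XP2].
have x0 : 0 <= x by exact: gap_ratio_ge0.
(* The term (n == 0)/8 is the room left by 7/8 = 1 - 1/8 for the first factor. *)
have small : (X + x) ^+ 2 / 8 <= X ^+ 2 / 8 + x * X + (n == 0%N)%:R / 8.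
  case: n @X @P @x nk {XP1 XP2} X0 x0 => [|n] /= nk.
    rewrite big_ord0 => _ x0.
    suff : gap_ratio R k 0 <= 1 by move: (gap_ratio R k 0) x0 => x x0 x1; nra.
    by rewrite /gap_ratio subr0 ler_pdivrMr ?ltr0n // mul1r ler_nat.
  rewrite mul0r addr0 => X0 x0.
  suff : gap_ratio R k n.+1 <= 6 * \sum_(j < n.+1) gap_ratio R k j.
    by move: (gap_ratio R k n.+1) x0 (\sum_(j < n.+1) _) X0 => x x0 X X0 xX; nra.
  apply: (@le_trans _ _ (6 * gap_ratio R k n)).
    have h : 1 <= k%:R - n.+1%:R :> R by rewrite lerBrDl natr1 ler_nat.
    rewrite /gap_ratio mulrA ler_pdivrMr ?(lt_le_trans _ h) // mulrAC.
    have h' : k%:R - n%:R = k%:R - n.+1%:R + 1 :> R by rewrite -natr1; ring.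
    rewrite h' ler_pdivlMr ?ltr_wpDl // ?(le_trans _ h) //.
    move: (k%:R - n.+1%:R) h {h'} => u h.
    rewrite -!muln2 -![(_ * _).+1%:R]natr1 !natrM -[n.+1%:R]natr1.
    have : 0 <= n%:R :> R by []; move: (n%:R) => v v0; nra.
  rewrite ler_pM2l // big_ord_recr /= lerDr sumr_ge0 // => j _.
  by rewrite gap_ratio_ge0 // (ltn_trans (ltn_ord j)) // ltnW.
have base : n = 0%N -> X = 0 /\ P = 1.
  by move=> n0; rewrite /X /P; move: n0 => ->; rewrite !big_ord0.
have xX : 0 <= x * X by exact: mulr_ge0.
have xXP : x * (1 + X) <= x * P by rewrite ler_wpM2l.
have [n0|n0] := eqVneq n 0%N.
  have [X_0 P_1] := base n0; move: small; rewrite X_0 P_1 n0 eqxx /= => small.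
  by split; lra.
move: small; rewrite (negbTE n0) /= mul0r addr0 => small.
by split; lra.
Qed.

(** The function t |-> (1 + t)^m - 1 is convex and vanishes at 0. *)
Lemma powB1_superadditive (R : realType) (m : nat) (x y : R) : 0 <= x -> 0 <= y ->
  ((1 + x) ^+ m - 1) + ((1 + y) ^+ m - 1) <= (1 + x + y) ^+ m - 1.
Proof.
move=> x0 y0; elim: m => [|m IH]; first by rewrite !expr0; lra.
rewrite !exprS.
have hx : 1 <= (1 + x) ^+ m by rewrite exprn_ege1 // lerDl.
have hy : 1 <= (1 + y) ^+ m by rewrite exprn_ege1 // lerDl.
have : (1 + x + y) * ((1 + x) ^+ m + (1 + y) ^+ m - 1) <= (1 + x + y) * (1 + x + y) ^+ m.
  by rewrite ler_wpM2l //; lra.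
have : y * 1 <= y * (1 + x) ^+ m by rewrite ler_wpM2l.
have : x * 1 <= x * (1 + y) ^+ m by rewrite ler_wpM2l.
by lra.
Qed.

Lemma sum_powB1_le (R : realType) (m n : nat) (x : nat -> R) :
  (forall j, (j < n)%N -> 0 <= x j) ->
  0 <= \sum_(j < n) ((1 + x j) ^+ m - 1) <= (1 + \sum_(j < n) x j) ^+ m - 1.
Proof.
move=> x0; apply/andP; split.
  by apply: sumr_ge0 => j _; rewrite subr_ge0 exprn_ege1 // lerDl x0.
elim: n x0 => [|n IH] x0; first by rewrite !big_ord0 addr0 expr1n subrr.
have x0' j : (j < n)%N -> 0 <= x j by move=> jn; rewrite x0 // ltnW.
rewrite !big_ord_recr /= [1 + (_ + _)]addrA.
have S0 : 0 <= \sum_(j < n) x j by apply: sumr_ge0 => j _; exact: x0'.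
by apply: (le_trans _ (powB1_superadditive m S0 (x0 n (ltnSn n)))); rewrite lerD2r IH.
Qed.

(** Pair the zero j with the pole -(j+1): since 1/(k-j) = (1 + x_j)/(k+j+1),
    each difference of m-th powers is ((1 + x_j)^m - 1)/(k+j+1)^m.  The last
    pole, -(n+1), is left unpaired and stays as the subtracted term. *)
Lemma pole_sum_tail (R : realType) (n k m : nat) : (n <= k)%N ->
  exists2 p : R, 0 <= p <= ((1 + \sum_(j < n) gap_ratio R k j) ^+ m - 1) / k.+1%:R ^+ m &
  pole_sum n predT m (k%:R : R) = p - ((k + n).+1%:R ^+ m)^-1.
Proof.
move=> nk.
have E j : (j < n)%N -> ((k%:R - j%:R) ^+ m)^-1 - ((k%:R + j.+1%:R : R) ^+ m)^-1 =
    ((1 + gap_ratio R k j) ^+ m - 1) / (k%:R + j.+1%:R) ^+ m.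
  move=> jn; have jk := leq_trans jn nk.
  have kj0 : k%:R + j.+1%:R != 0 :> R by rewrite -natrD pnatr_eq0 addnS.
  by rewrite mulrBl mul1r gap_ratio1 // expr_div_n mulrAC mulfV ?mul1r //.
exists (\sum_(j < n) ((1 + gap_ratio R k j) ^+ m - 1) / (k%:R + j.+1%:R) ^+ m); last first.
  rewrite /pole_sum big_ord_recr /= opprD addrA -sumrB -natrD addnS; congr (_ - _).
  by apply: eq_bigr => j _; rewrite E.
have x0 j : (j < n)%N -> 0 <= gap_ratio R k j.
  by move=> jn; rewrite gap_ratio_ge0 // (leq_trans jn).
have t0 j : (j < n)%N -> 0 <= (1 + gap_ratio R k j) ^+ m - 1.
  by move=> jn; rewrite subr_ge0 exprn_ege1 // lerDl x0.
apply/andP; split.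
  by apply: sumr_ge0 => j _; rewrite divr_ge0 ?t0 // exprn_ge0 // -natrD.
have /andP[_] := sum_powB1_le m x0.
rewrite -(ler_pM2r (_ : 0 < (k.+1%:R ^+ m : R)^-1)) ?invr_gt0 ?exprn_gt0 //.
apply: le_trans; rewrite mulr_suml; apply: ler_sum => j _.
rewrite ler_wpM2l ?t0 // lef_pV2 ?posrE ?exprn_gt0 -?natrD ?ltr0n ?addnS //.
by rewrite lerXn2r ?nnegrE // ler_nat ltnS leq_addr.
Qed.

(** Expand and estimate the positive and the negative monomials separately: the
    expression lies between -(12 X^3 + 48 X^2 + 24) and 12 X^3 + 24 X^2 + 72 X,
    and both are dominated by 40 (7/8 + X + X^2/8)^2. *)
Lemma tail_polynomial_bound (R : realType) (X P a b c e : R) :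
  0 <= X -> 7 / 8 + X + X ^+ 2 / 8 <= P -> 0 <= e <= 1 ->
  0 <= a <= (1 + X) ^+ 1 - 1 -> 0 <= b <= (1 + X) ^+ 2 - 1 -> 0 <= c <= (1 + X) ^+ 3 - 1 ->
  `|8 * (a - e) ^+ 3 - 12 * ((a - e) * (b - e ^+ 2)) + 4 * (c - e ^+ 3)| <= 40 * P ^+ 2.
Proof.
move=> X0 XP /andP[e0 e1] /andP[a0 aX] /andP[b0 bX] /andP[c0 cX].
have {}aX : a <= X by rewrite expr1 in aX; lra.
have {}bX : b <= 2 * X + X ^+ 2 by apply: le_trans bX _; rewrite le_eqVlt; apply/orP; left; apply/eqP; ring.
have {}cX : c <= 3 * X + 3 * X ^+ 2 + X ^+ 3 by apply: le_trans cX _; rewrite le_eqVlt; apply/orP; left; apply/eqP; ring.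
set Q := 7 / 8 + X + X ^+ 2 / 8 in XP.
have Q0 : 0 <= Q by rewrite /Q; nra.
have QP : Q ^+ 2 <= P ^+ 2 by rewrite lerXn2r ?nnegrE ?(le_trans Q0).
(* Each monomial of the expansion is bounded by its value at a = X,
   b = 2X + X^2, c = 3X + 3X^2 + X^3, e = 1. *)
have a2 : a ^+ 2 <= X ^+ 2 by rewrite lerXn2r ?nnegrE.
have a3 : a ^+ 3 <= X ^+ 3 by rewrite lerXn2r ?nnegrE.
have e2 : e ^+ 2 <= 1 by rewrite exprn_ile1.
have e3 : e ^+ 3 <= 1 by rewrite exprn_ile1.
have ae2 : a * e ^+ 2 <= X * 1 by rewrite ler_pM ?exprn_ge0.
have a2e : a ^+ 2 * e <= X ^+ 2 * 1 by rewrite ler_pM ?exprn_ge0.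
have eb : b * e <= (2 * X + X ^+ 2) * 1 by rewrite ler_pM.
have ab : a * b <= X * (2 * X + X ^+ 2) by rewrite ler_pM.
have a30 : 0 <= a ^+ 3 by exact: exprn_ge0.
have ae20 : 0 <= a * e ^+ 2 by rewrite mulr_ge0 ?exprn_ge0.
have eb0 : 0 <= b * e by rewrite mulr_ge0.
have a2e0 : 0 <= a ^+ 2 * e by rewrite mulr_ge0 ?exprn_ge0.
have e30 : 0 <= e ^+ 3 by exact: exprn_ge0.
have ab0 : 0 <= a * b by rewrite mulr_ge0.
have QE : 40 * Q ^+ 2 = 245 / 8 + 70 * X + 195 / 4 * X ^+ 2 + 10 * X ^+ 3 + 5 / 8 * X ^+ 4.
  by rewrite /Q; field.
have X0' : 0 <= (X - 1) ^+ 2 by exact: sqr_ge0.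
(* The squares X^2 (X-2)^2 and (X^2-5)^2 compensate the cubic terms, and
   (X-1)^2 the linear ones. *)
have X3 : 0 <= X ^+ 4 - 4 * X ^+ 3 + 4 * X ^+ 2.
  by rewrite (_ : _ + _ = X ^+ 2 * (X - 2) ^+ 2); [rewrite mulr_ge0 ?sqr_ge0|ring].
have X4 : 0 <= X ^+ 4 - 10 * X ^+ 2 + 25.
  by rewrite (_ : _ + _ = (X ^+ 2 - 5) ^+ 2); [rewrite sqr_ge0|ring].
have -> : 8 * (a - e) ^+ 3 - 12 * ((a - e) * (b - e ^+ 2)) + 4 * (c - e ^+ 3) =
    8 * a ^+ 3 - 24 * (a ^+ 2 * e) + 36 * (a * e ^+ 2) - 24 * e ^+ 3 - 12 * (a * b) +
    12 * (b * e) + 4 * c by ring.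
have X2 : 0 <= X ^+ 2 by exact: sqr_ge0.
rewrite ler_norml; apply/andP; split; lra.
Qed.

(** Every [pole_sum] of order m scales like (k+1)^(-m) and g(k)^2 is at most
    1/((k+1)^2 P^2), so the third derivative of g^2 scales like
    (k+1)^(-5); the remaining factor is [tail_polynomial_bound]. *)
Lemma moment_term_tail_le (R : realType) (n k : nat) : (n <= k)%N ->
  `|moment_term (legendreP R n) k| <= 40 / k.+1%:R ^+ 5.
Proof.
move=> nk; rewrite moment_term_tailE //.
have [a a01 ->] := pole_sum_tail R 1 nk.
have [b b01 ->] := pole_sum_tail R 2 nk.
have [c c01 ->] := pole_sum_tail R 3 nk.
have [X0 XP1 XP2] := gap_ratio_prod_ge R nk.
move: a01 b01 c01 X0 XP1 XP2.
set X := \sum_(j < n) _; set P := \prod_(j < n) _ => a01 b01 c01 X0 XP1 XP2.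
set d : R := (k.+1%:R)^-1.
have d0 : 0 < d by rewrite invr_gt0.
have P1 : 1 <= P by lra.
have P0 : P != 0 by rewrite gt_eqF // (lt_le_trans ltr01).
set e : R := ((k + n).+1%:R)^-1.
have e0 : 0 < e by rewrite invr_gt0.
have ed : e <= d by rewrite lef_pV2 ?posrE // ler_nat ltnS leq_addr.
have gE : root_frac n predT (k%:R : R) = e / P.
  rewrite /root_frac /= big_ord_recr /= invfM -natrD addnS -/e mulrA mulrC; congr (_ * _).
  rewrite -prodf_div -prodfV; apply: eq_bigr => j _.
  by rewrite gap_ratio1 ?invf_div // (leq_trans (ltn_ord j)).
(* Every quantity is measured in powers of d = 1/(k+1). *)
have scale m x : 0 <= x <= ((1 + X) ^+ m - 1) / k.+1%:R ^+ m ->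
    exists2 y, 0 <= y <= (1 + X) ^+ m - 1 & x = d ^+ m * y.
  move=> /andP[x0 xX]; have k0 : (0 : R) < k.+1%:R ^+ m by rewrite exprn_gt0.
  exists (x * k.+1%:R ^+ m).
    by rewrite mulr_ge0 ?(ltW k0) //= -ler_pdivlMr.
  by rewrite /d exprVn mulrCA mulVf ?mulr1 ?gt_eqF.
have [a' a'01 ->] := scale _ _ a01.
have [b' b'01 ->] := scale _ _ b01.
have [c' c'01 ->] := scale _ _ c01.
have [t [t01 et]] : exists t, 0 <= t <= 1 /\ e = d * t.
  exists (e / d); split; last by rewrite mulrC divfK ?gt_eqF.
  by rewrite divr_ge0 ?(ltW e0) ?(ltW d0) //= ler_pdivrMr // mul1r.
have -> : ((k + n).+1%:R ^+ 2)^-1 = d ^+ 2 * t ^+ 2 by rewrite -exprMn -et exprVn.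
have -> : ((k + n).+1%:R ^+ 3)^-1 = d ^+ 3 * t ^+ 3 by rewrite -exprMn -et exprVn.
have B := tail_polynomial_bound X0 XP2 t01 a'01 b'01 c'01.
have -> : 40 / k.+1%:R ^+ 5 = d ^+ 5 * 40 :> R by rewrite /d exprVn mulrC.
rewrite gE et.
have -> : (d * t / P) ^+ 2 * (8 * (d ^+ 1 * a' - d * t) ^+ 3 -
    12 * ((d ^+ 1 * a' - d * t) * (d ^+ 2 * b' - d ^+ 2 * t ^+ 2)) +
    4 * (d ^+ 3 * c' - d ^+ 3 * t ^+ 3)) =
  d ^+ 5 * (t ^+ 2 * (P ^- 2 * (8 * (a' - t) ^+ 3 - 12 * ((a' - t) * (b' - t ^+ 2)) +
    4 * (c' - t ^+ 3)))) by field.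
rewrite normrM ger0_norm ?exprn_ge0 ?(ltW d0) // ler_pM2l ?exprn_gt0 //.
rewrite normrM ger0_norm ?sqr_ge0 // normrM ger0_norm ?invr_ge0 ?sqr_ge0 //.
have /andP[t0 t1] := t01.
rewrite -[leRHS]mul1r ler_pM ?sqr_ge0 ?exprn_ile1 ?mulr_ge0 ?invr_ge0 ?sqr_ge0 //.
by rewrite mulrC ler_pdivrMr // exprn_gt0 // (lt_le_trans ltr01).
Qed.

(** With x = k + 1, the difference 10/(k(k+1))^2 - 10/((k+1)(k+2))^2 equals
    40/(x (x^2-1)^2), which is at least 40/x^5. *)
Lemma sum_inv_pow5_le (R : realType) (n m : nat) : (0 < n)%N ->
  \sum_(n <= k < n + m) (40 / k.+1%:R ^+ 5 : R) <=
  10 / (n%:R * n.+1%:R) ^+ 2 - 10 / ((n + m)%:R * (n + m).+1%:R) ^+ 2.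
Proof.
move=> n0; elim: m => [|m IH]; first by rewrite addn0 big_geq ?subrr.
rewrite addnS big_nat_recr ?leq_addr //=.
have step k : (0 < k)%N -> 40 / k.+1%:R ^+ 5 <=
    10 / (k%:R * k.+1%:R) ^+ 2 - 10 / (k.+1%:R * k.+2%:R) ^+ 2 :> R.
  move=> k0; have -> : k.+2%:R = k.+1%:R + 1 :> R by rewrite natr1.
  have -> : k%:R = k.+1%:R - 1 :> R by rewrite -natr1 addrK.
  have : 2 <= k.+1%:R :> R by rewrite ler_nat.
  move: (k.+1%:R) => x x2.
  have x0 : x != 0 by rewrite gt_eqF //; lra.
  have xm : x - 1 != 0 by rewrite gt_eqF //; lra.
  have xp : x + 1 != 0 by rewrite gt_eqF //; lra.
  have -> : 10 / ((x - 1) * x) ^+ 2 - 10 / (x * (x + 1)) ^+ 2 =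
      40 / (x * ((x ^+ 2 - 1) ^+ 2)).
    have -> : x ^+ 2 - 1 = (x - 1) * (x + 1) by ring.
    by field; rewrite x0 xm xp.
  have x21 : 0 < x ^+ 2 - 1 by nra.
  rewrite ler_pM2l // lef_pV2 ?posrE ?mulr_gt0 ?exprn_gt0 //; try lra.
  have -> : x ^+ 5 = x * (x ^+ 2) ^+ 2 by ring.
  rewrite ler_pM2l; last by lra.
  by rewrite lerXn2r ?nnegrE ?sqr_ge0 ?(ltW x21) // gerBl.
have := step (n + m)%N; rewrite addn_gt0 n0 => /(_ isT).
move=> {}step; apply: le_trans (lerD IH step) _.
by rewrite addrA subrK.
Qed.

(** * The head of the series *)

Lemma fact_mul_le (n k : nat) : (k.+1`! * n.+1`! <= (n.+1 + k)`!)%N.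
Proof.
elim: k => [|k IH]; first by rewrite mul1n addn0.
by rewrite addnS (factS (n.+1 + k)) (factS k.+1) -mulnA leq_mul // addSn !ltnS leq_addl.
Qed.

Lemma root_frac_head_sqr (R : realType) (n k : nat) : (k <= n)%N ->
  root_frac n.+1 (predC1 k) (k%:R : R) ^+ 2 =
  ((k`! * k`! * (n - k)`!)%:R / (k + n.+2)`!%:R) ^+ 2.
Proof.
move=> kn; rewrite /root_frac /=.
have -> : \prod_(j < n.+1 | j != k :> nat) (k%:R - j%:R : R) =
    (-1) ^+ #|[pred j : 'I_n.+1 | j != k :> nat]| * ((-1) ^+ k * (k`! * (n - k)`!)%:R).
  rewrite -prod_natr_sub_neq // -prodrN; apply: eq_bigr => j _; by rewrite opprB.
have <- : \prod_(j < n.+2) (k.+1%:R + j%:R) * k`!%:R = (k + n.+2)`!%:R :> R.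
  exact: prod_natr_shift.
have k0 : k`!%:R != 0 :> R by rewrite pnatr_eq0 -lt0n fact_gt0.
have -> : \prod_(j < n.+2) (k%:R + j.+1%:R : R) = \prod_(j < n.+2) (k.+1%:R + j%:R).
  by apply: eq_bigr => j _; rewrite -!natrD addSnnS.
have D0 : \prod_(j < n.+2) (k.+1%:R + j%:R) != 0 :> R.
  by apply/prodf_neq0 => j _; rewrite -natrD pnatr_eq0 addSn.
rewrite !exprMn !sqrr_sign !mul1r !natrM.
by move: (k`!%:R) ((n - k)`!%:R) (\prod_(j < n.+2) _) k0 D0 => u v D u0 D0; field; rewrite u0 D0.
Qed.

(** The quotient k!^2 (n-k)!/(k+n+2)! is
    1/((n+1)(n+2) binomial(n,k) binomial(k+n+2,k)), and the last binomial
    coefficient is at least n + 3 when k > 0. *)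
Lemma root_frac_head_le (R : realType) (n k : nat) : (0 < k <= n)%N ->
  root_frac n.+1 (predC1 k) (k%:R : R) ^+ 2 <=
  ((n.+1%:R * n.+2%:R) ^+ 2)^-1 / n.+3%:R ^+ 2.
Proof.
move=> /andP[k0 kn]; rewrite root_frac_head_sqr // -invfM -exprMn -exprVn.
rewrite lerXn2r ?nnegrE ?divr_ge0 ?invr_ge0 ?mulr_ge0 //.
rewrite ler_pdivrMr ?ltr0n ?fact_gt0 // mulrC ler_pdivlMr ?mulr_gt0 ?ltr0n //.
rewrite -!natrM ler_nat.
have b : (k`! * (n - k)`! <= n`!)%N by rewrite -(bin_fact kn) leq_pmull // bin_gt0.
have fl : (k`! * n.+3`! <= (k + n.+2)`!)%N.
  by have := fact_mul_le n.+2 k.-1; rewrite addSnnS prednK // addnC.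
apply: leq_trans fl; rewrite !factS.
have -> : (k`! * (n.+3 * (n.+2 * (n.+1 * n`!))) = k`! * n`! * (n.+1 * n.+2 * n.+3))%N by lia.
by rewrite leq_mul // -mulnA leq_mul.
Qed.

(** There are n zeros and n + 2 poles, all at distance at least 1 from k. *)
Lemma pole_sum_head_norm_le (R : realType) (n k : nat) : (k <= n)%N ->
  `|pole_sum n.+1 (predC1 k) 1 (k%:R : R)| <= 2 * n.+1%:R.
Proof.
move=> kn; rewrite /pole_sum; apply: le_trans (ler_normB _ _) _.
have A : `|\sum_(j < n.+1 | predC1 k j) ((k%:R - j%:R : R) ^+ 1)^-1| <= n%:R.
  apply: le_trans (ler_norm_sum _ _ _) _.
  apply: (@le_trans _ _ (\sum_(j < n.+1 | predC1 k j) 1)).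
    apply: ler_sum => j /= jk; rewrite expr1 normfV.
    suff h : 1 <= `|k%:R - j%:R| :> R by rewrite invf_le1 ?(lt_le_trans ltr01 h).
    case: (ltngtP j k) jk => // jk _.
      by rewrite -natrB 1?ltnW // normr_nat ler1n subn_gt0.
    by rewrite distrC -natrB 1?ltnW // normr_nat ler1n subn_gt0.
  rewrite sumr_const ler_nat.
  have -> : #|[pred j : 'I_n.+1 | predC1 k j]| = #|predC1 (Ordinal (kn : k < n.+1)%N)|.
    by apply: eq_card.
  by rewrite cardC1 card_ord.
have B : `|\sum_(j < n.+2) ((k%:R + j.+1%:R : R) ^+ 1)^-1| <= n.+2%:R.
  apply: le_trans (ler_norm_sum _ _ _) _.
  apply: (@le_trans _ _ (\sum_(j < n.+2) 1)).
    apply: ler_sum => j _; rewrite expr1 -natrD addnS normfV ger0_norm // invf_le1 ?ltr0n //.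
    by rewrite ler1n.
  by rewrite sumr_const card_ord.
by apply: le_trans (lerD A B) _; rewrite -natrD -natrM ler_nat; lia.
Qed.

Lemma pole_sum_head0E (R : realType) (n : nat) :
  pole_sum n.+1 (predC1 0%N) 1 (0 : R) =
  - (\sum_(j < n) (j.+1%:R)^-1 + \sum_(j < n.+2) (j.+1%:R)^-1).
Proof.
rewrite /pole_sum big_mkcond big_ord_recl /= add0r opprD; congr (_ - _).
  rewrite -sumrN; apply: eq_bigr => j _.
  by rewrite /= expr1 add0r invrN.
by apply: eq_bigr => j _; rewrite expr1 add0r.
Qed.

(** * Summing the series *)

Lemma moment_term_0E (R : realType) (m : nat) :
  moment_term (legendreP R m.+1) 0 = - (12 *
    (\sum_(j < m) (j.+1%:R)^-1 + \sum_(j < m.+2) (j.+1%:R)^-1)) /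
    (m.+1%:R * m.+2%:R) ^+ 2.
Proof.
rewrite moment_term_headE // root_frac_head_sqr // pole_sum_head0E fact0 !mul1n subn0 add0n.
have -> : (m`!%:R / m.+2`!%:R) ^+ 2 = ((m.+1%:R * m.+2%:R) ^+ 2)^-1 :> R.
  have m0 : m`!%:R != 0 :> R by rewrite pnatr_eq0 -lt0n fact_gt0.
  rewrite !factS !natrM -exprVn; congr (_ ^+ 2).
  have m1 : m.+1%:R != 0 :> R by rewrite pnatr_eq0.
  have m2 : m.+2%:R != 0 :> R by rewrite pnatr_eq0.
  by move: (m.+1%:R) (m.+2%:R) (m`!%:R) m0 m1 m2 => a b c c0 a0 b0; field; rewrite a0 b0 c0.
by move: (\sum_(j < m) _) (\sum_(j < m.+2) _) (_ ^-1) => a b c; ring.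
Qed.

Lemma moment_terms_head_le (R : realType) (m : nat) :
  `|\sum_(1 <= k < m.+1) moment_term (legendreP R m.+1) k| <=
  24 * (m%:R * m.+1%:R) / m.+3%:R ^+ 2 / (m.+1%:R * m.+2%:R) ^+ 2.
Proof.
apply: le_trans (ler_norm_sum _ _ _) _.
pose c : R := 24 * m.+1%:R / m.+3%:R ^+ 2 / (m.+1%:R * m.+2%:R) ^+ 2.
apply: (@le_trans _ _ (\sum_(1 <= k < m.+1) c)); last first.
  by rewrite sumr_const_nat subn1 /= -mulr_natr /c le_eqVlt; apply/orP; left; apply/eqP; ring.
rewrite big_nat_cond [leRHS]big_nat_cond; apply: ler_sum => k /andP[/andP[k0 km] _].
rewrite moment_term_headE // (normrM 12) (ger0_norm (ler0n R 12)).
rewrite (normrM (_ ^+ 2)) (ger0_norm (sqr_ge0 _)).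
have A := @root_frac_head_le R m k; rewrite k0 /= in A.
have B := pole_sum_head_norm_le R (km : (k <= m)%N).
have C := ler_pM (sqr_ge0 _) (normr_ge0 _) (A km) B.
apply: (le_trans (ler_wpM2l (ler0n R 12) C)).
by rewrite /c le_eqVlt; apply/orP; left; apply/eqP; ring.
Qed.

Lemma moment_terms_tail_sum_le (R : realType) (m N : nat) :
  `|\sum_(m.+1 <= k < m.+1 + N) moment_term (legendreP R m.+1) k| <=
  10 / (m.+1%:R * m.+2%:R) ^+ 2.
Proof.
apply: le_trans (ler_norm_sum _ _ _) _.
apply: (@le_trans _ _ (\sum_(m.+1 <= k < m.+1 + N) 40 / k.+1%:R ^+ 5)).
  rewrite big_nat_cond [leRHS]big_nat_cond; apply: ler_sum => k /andP[/andP[mk _] _].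
  exact: moment_term_tail_le.
apply: le_trans (sum_inv_pow5_le R N (ltn0Sn m)) _.
by rewrite lerBlDr lerDl divr_ge0 ?exprn_ge0 ?mulr_ge0.
Qed.

(** The first terms of the harmonic sums suffice: they make the right-hand
    side 18, 34 and at least 43 for m = 0, 1 and m >= 2, against 16, 19 and
    at most 40. *)
Lemma harmonic_head_ge (R : realType) (m : nat) :
  24 * (m%:R * m.+1%:R) / m.+3%:R ^+ 2 + 16 <=
  12 * (\sum_(j < m) (j.+1%:R)^-1 + \sum_(j < m.+2) (j.+1%:R)^-1) :> R.
Proof.
case: m => [|[|m]].
- by rewrite !big_ord_recr !big_ord0 /=; lra.
- by rewrite !big_ord_recr !big_ord0 /=; lra.
(* The constants are 24 + 16 = 40 <= 12 (3/2 + 25/12) = 43. *)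
have r : (m.+2%:R * m.+3%:R) / m.+2.+3%:R ^+ 2 <= 1 :> R.
  by rewrite ler_pdivrMr ?exprn_gt0 ?ltr0n // mul1r -natrM -natrX ler_nat; lia.
have a : 3 / 2 <= \sum_(j < m.+2) (j.+1%:R)^-1 :> R.
  rewrite -(big_mkord xpredT (fun j => (j.+1%:R)^-1)) 2?big_ltn //.
  have : 0 <= \sum_(2 <= j < m.+2) (j.+1%:R)^-1 :> R by rewrite sumr_ge0.
  by move: (\sum_(2 <= j < m.+2) _) => s; lra.
have b : 25 / 12 <= \sum_(j < m.+4) (j.+1%:R)^-1 :> R.
  rewrite -(big_mkord xpredT (fun j => (j.+1%:R)^-1)) 4?big_ltn //.
  have : 0 <= \sum_(4 <= j < m.+4) (j.+1%:R)^-1 :> R by rewrite sumr_ge0.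
  by move: (\sum_(4 <= j < m.+4) _) => s; lra.
move: (\sum_(j < m.+2) _) (\sum_(j < m.+4) _) a b r => a b a0 b0 r.
by rewrite -mulrA; move: (_ / _ ^+ 2) r => t r; lra.
Qed.

Lemma moment_terms_sum_bounds (R : realType) (m N : nat) :
  6 / (m.+1%:R * m.+2%:R) ^+ 2 <=
  - (\sum_(0 <= k < m.+1 + N) moment_term (legendreP R m.+1) k) <=
  (27 * m.+1%:R + 7) / (m.+1%:R * m.+2%:R) ^+ 2.
Proof.
rewrite (big_cat_nat _ (_ : m.+1 <= m.+1 + N)%N) ?leq_addr //= big_ltn //.
have H := moment_terms_head_le R m; have T := moment_terms_tail_sum_le R m N.
have Lo := harmonic_head_ge R m.
have Hi : \sum_(j < m) (j.+1%:R)^-1 + \sum_(j < m.+2) (j.+1%:R)^-1 <= 2 * m.+1%:R :> R.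
  have := pole_sum_head_norm_le R (leq0n m); rewrite pole_sum_head0E normrN.
  exact/le_trans/ler_norm.
(* 8(m+1) <= (m+3)^2 is (m-1)^2 >= 0. *)
have r : 24 * (m%:R * m.+1%:R) / m.+3%:R ^+ 2 <= 3 * m%:R :> R.
  rewrite ler_pdivrMr ?exprn_gt0 ?ltr0n // -!natr1.
  have := sqr_ge0 (m%:R - 1 : R); have : 0 <= m%:R :> R by [].
  by move: (m%:R) => x; nra.
have mE : m.+1%:R = m%:R + 1 :> R by rewrite natr1.
rewrite moment_term_0E; move: H T Lo Hi r.
set t := 24 * _ / _; set S := \sum_(j < m) _ + _; set w := _ ^+ 2; set h := \sum_(1 <= k < _) _.
set u := \sum_(m.+1 <= k < _) _ => H T Lo Hi r.
have w0 : 0 < w by rewrite exprn_gt0 // mulr_gt0 ?ltr0n.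
move: H; rewrite ler_norml -mulNr ler_pdivrMr // ler_pdivlMr // => /andP[H1 H2].
move: T; rewrite ler_norml -mulNr ler_pdivrMr // ler_pdivlMr // => /andP[T1 T2].
rewrite ler_pdivrMr // ler_pdivlMr //.
have -> : - (- (12 * S) / w + h + u) * w = 12 * S - h * w - u * w.
  by field; rewrite gt_eqF.
by apply/andP; split; lra.
Qed.

Theorem theorem6 (R : realType) (n : nat) (hn : (1 <= n)%N) :
  6 / (n%:R + 1) ^+ 4 <= J3 R n /\
  J3 R n <= 6 * (@pi R) ^+ 2 / (n%:R + 1 / 2) ^+ 2.
Proof.
case: n hn => // m _.
have lim : - (\sum_(0 <= k < m.+1 + N) moment_term (legendreP R m.+1) k) @[N --> \oo] --> J3 R m.+1.
  move/cvgN: (@Rintegral_series R (legendreP R m.+1)).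
  by rewrite -(cvg_shiftn m.+1) /=; under eq_fun do rewrite addnC.
have x1 : 1 <= m.+1%:R :> R by rewrite ler1n.
have x2E : m.+2%:R = m.+1%:R + 1 :> R by rewrite natr1.
have Lo : 6 / (m.+1%:R * m.+2%:R) ^+ 2 <= J3 R m.+1.
  rewrite -(cvg_lim _ lim) //; apply: limr_ge; first by apply/cvg_ex; exists (J3 R m.+1).
  by apply: nearW => N; have /andP[] := moment_terms_sum_bounds R m N.
have Up : J3 R m.+1 <= (27 * m.+1%:R + 7) / (m.+1%:R * m.+2%:R) ^+ 2.
  rewrite -(cvg_lim _ lim) //; apply: limr_le; first by apply/cvg_ex; exists (J3 R m.+1).
  by apply: nearW => N; have /andP[] := moment_terms_sum_bounds R m N.
have pi4 : 4 <= (@pi R) ^+ 2 by have := @pi_ge2 R; nra.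
split.
  apply: le_trans Lo; rewrite x2E.
  rewrite ler_pM2l // lef_pV2 ?posrE ?exprn_gt0 ?mulr_gt0 ?addr_gt0 //.
  have -> : (m.+1%:R + 1) ^+ 4 = ((m.+1%:R + 1) ^+ 2) ^+ 2 :> R by rewrite -exprM.
  rewrite lerXn2r ?nnegrE ?mulr_ge0 ?exprn_ge0 ?addr_ge0 //.
  by rewrite expr2 ler_wpM2r ?addr_ge0 // lerDl.
apply: (le_trans Up).
apply: (@le_trans _ _ (24 / (m.+1%:R + 1 / 2) ^+ 2)); last first.
  by rewrite ler_pM2r ?invr_gt0 ?exprn_gt0 ?addr_gt0 //; lra.
rewrite x2E; move: (m.+1%:R) x1 => x x1.
rewrite ler_pdivrMr ?exprn_gt0 ?mulr_gt0 //; try lra.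
rewrite mulrAC ler_pdivlMr ?exprn_gt0 //; last by lra.
have x2 : 1 <= x ^+ 2 by rewrite exprn_ege1.
have x3 : x <= x ^+ 2 by rewrite expr2 ler_peMl //; lra.
have x4 : x ^+ 2 <= x ^+ 4.
  by rewrite (_ : x ^+ 4 = x ^+ 2 * x ^+ 2); [rewrite ler_peMl //; lra|ring].
have x5 : x <= x ^+ 3.
  by rewrite (_ : x ^+ 3 = x ^+ 2 * x); [rewrite ler_peMl //; lra|ring].
have -> : 24 * (x * (x + 1)) ^+ 2 = 24 * x ^+ 4 + 48 * x ^+ 3 + 24 * x ^+ 2 by ring.
have -> : (27 * x + 7) * (x + 1 / 2) ^+ 2 =
    27 * x ^+ 3 + 34 * x ^+ 2 + 55 / 4 * x + 7 / 4 by field.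
by lra.
Qed.
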